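(* Let $m\in\mathbb{Z}_+$ and let $B_0,\ldots,B_m$ be closed linear operators from $H$ to $H'$ with domains $\mathcal{D}(B_j)\subset H$ such that: $e_n\in\bigcap_{j=0}^m\mathcal{D}(B_j)$ for every $n\in M$; $(B_je_{n'},B_je_{n''})_{H'}=0$ for all $j\in\{0,\ldots,m\}$ and all $n',n''\in M$ with $n'\neq n''$; and there exist $j_0\in\{0,\ldots,m\}$ and $n_0\in M$ with $B_{j_0}e_{n_0}\neq0$. Let $A:H\to H'$ be a closable linear operator with domain $\mathcal{D}(A)\subset H$ such that $e_n\in\mathcal{D}(A)$ for every $n\in M$ and $Ae_{n_0}\neq0$ for some $n_0\in M$. Assume that $$\sup_{f\in H':\,\|f\|_{H'}\leqslant1}\ \widetilde{\sum_{n\in M}}\frac{|(f,Ae_n)_{H'}|^2}{b_{n,\mathbf{1}}}<\infty .$$ Then for every $\mathbf{h}\in\mathbb{R}_+^{m+1}$ and every $x\in\mathcal{D}(A)\cap H_{\mathbf{B}}$, $$\|Ax\|_{H'}\leqslant\left(\sup_{f\in H':\,\|f\|_{H'}\leqslant1}\ \widetilde{\sum_{n\in M}}\frac{|(f,Ae_n)_{H'}|^2}{b_{n,\mathbf{h}}}\right)^{1/2}\|x\|_{\mathbf{B},\mathbf{h}},$$ and this inequality is sharp (for each $\mathbf{h}$ the constant cannot be replaced by a smaller one).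
   Context: $\mathbb{R}_+=(0,+\infty)$; $\mathbb{Z}_+$ is the set of non-negative integers; $\mathbf{1}=(1,\ldots,1)$. $H$ is a separable Hilbert space over $\mathbb{C}$ with orthonormal basis $\{e_n\}_{n\in M}$, $M$ finite or countable; $x_n:=(x,e_n)_H$. Sums over $M$ are limits of sums over a fixed sequence of nested finite sets $M_1\subset M_2\subset\ldots$ with union $M$. $H'$ is a Hilbert space over $\mathbb{C}$. For non-negative sequences $\{a_n\},\{b_n\}$, the sum $\widetilde{\sum}_{n\in M}\frac{a_n}{b_n}$ equals $+\infty$ if there is $n_0$ with $a_{n_0}\neq0$ and $b_{n_0}=0$, and otherwise equals $\sum_{n\in M:\,b_n\neq0}\frac{a_n}{b_n}$ (an empty sum is $0$). For $\mathbf{h}=(h_0,\ldots,h_m)\in\mathbb{R}_+^{m+1}$: $b_{n,\mathbf{h}}:=\sum_{j=0}^m h_j\|B_je_n\|_{H'}^2$. Further, $H_{\mathbf{B}}:=\{x\in H:\ \sum_{n\in M}|x_n|^2\|B_je_n\|_{H'}^2<\infty,\ j=0,\ldots,m\}$ and $\|x\|_{\mathbf{B},\mathbf{h}}:=\left(\sum_{n\in M}|x_n|^2b_{n,\mathbf{h}}\right)^{1/2}$ for $x\in H_{\mathbf{B}}$ (a seminorm). An operator is closable if the closure of its graph is the graph of an operator. *)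

(* Defs.v *)
(* The complex numbers are R[i] for R : realType. *)
From HB Require Import structures.
From mathcomp Require Import all_boot all_order all_algebra.
From mathcomp Require Import finmap.
From mathcomp Require Import all_classical all_reals all_analysis.
From mathcomp.real_closed Require Import complex.
Set Implicit Arguments.
Unset Strict Implicit.
Unset Printing Implicit Defensive.
Import Order.TTheory GRing.Theory Num.Theory.
Import numFieldNormedType.Exports.
Local Open Scope classical_set_scope.
Local Open Scope ring_scope.

(* The inner product is linear in its first argument and conjugate-linear in
   the second one; the norm of the library is R[i]-valued. *)
Record hilbertType (R : realType) := HilbertType {
  hilbert_sort :> completeNormedModType R[i];
  inner : {dot hilbert_sort for Num.conj};
  innerE : forall x : hilbert_sort, inner x x = `|x| ^+ 2 }.

(* The norm, a nonnegative real element of R[i], seen as an element of R;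
   it also serves for the modulus when V is R[i] itself. *)
Definition rnorm (R : realType) (V : normedZmodType R[i]) (v : V) : R :=
  complex.Re `|v|.

(* The values of op_fun outside the domain are irrelevant. *)
Record operator (R : realType) (H H' : hilbertType R) := Operator {
  dom : set H;
  op_fun :> H -> H';
  dom_submod : GRing.submod_closed [in dom];
  op_linear : forall (a : R[i]) (u v : H), dom u -> dom v ->
    op_fun (a *: u + v) = a *: op_fun u + op_fun v }.

Section Operators.
Variables (R : realType) (H H' : hilbertType R).

Definition graph (T : operator H H') : set (H * H') :=
  [set p | dom T p.1 /\ p.2 = T p.1].

Definition closed_op (T : operator H H') : Prop := closed (graph T).

Definition closable_op (T : operator H H') : Prop :=
  exists S : operator H H', closure (graph T) = graph S.

End Operators.

Definition exhaustion (M : countType) (Mk : nat -> {fset M}) : Prop :=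
  (forall k, (Mk k `<=` Mk k.+1)%fset) /\ (forall n, exists k, n \in Mk k).

Section Sums.
Variables (R : realType) (M : countType) (Mk : nat -> {fset M}).

Definition msum_on (P : pred M) (a : M -> R) : \bar R :=
  limn (fun k => (\sum_(n <- Mk k | P n) (a n)%:E)%E).

Definition msum (a : M -> R) : \bar R := msum_on predT a.

Definition wsum (a b : M -> R) : \bar R :=
  if `[< exists n, a n != 0 /\ b n = 0 >] then +oo%E
  else msum_on (fun n => b n != 0) (fun n => a n / b n).

End Sums.

Definition orthonormal_basis (R : realType) (H : hilbertType R)
    (M : countType) (Mk : nat -> {fset M}) (e : M -> H) : Prop :=
  (forall n n', inner H (e n) (e n') = (n == n')%:R) /\
  (forall x : H,
     (fun k => \sum_(n <- Mk k) inner H x (e n) *: e n) @ \oo --> x).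

Section Weights.
Variables (R : realType) (H H' : hilbertType R) (M : countType).
Variables (Mk : nat -> {fset M}) (e : M -> H) (m : nat).
Variable B : 'I_m.+1 -> operator H H'.

Definition weight (h : 'I_m.+1 -> R) (n : M) : R :=
  \sum_(j < m.+1) h j * rnorm (B j (e n)) ^+ 2.

Definition HB_space : set H :=
  [set x | forall j : 'I_m.+1,
    (msum Mk (fun n =>
       (rnorm (inner H x (e n)) ^+ 2 * rnorm (B j (e n)) ^+ 2)%R) < +oo)%E].

(* Extended-real valued so that it makes sense for every x; it is finite on
   HB_space. *)
Definition seminormB (h : 'I_m.+1 -> R) (x : H) : \bar R :=
  sqrte (msum Mk (fun n => rnorm (inner H x (e n)) ^+ 2 * weight h n)).

(* The supremum over the unit ball of H', before taking the square root. *)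
Definition sup_wsum (A : operator H H') (h : 'I_m.+1 -> R) : \bar R :=
  ereal_sup
    [set wsum Mk (fun n => rnorm (inner H' f (A (e n))) ^+ 2) (weight h)
    | f in [set f : H' | rnorm f <= 1]].

End Weights.

(* Main.v *)
(** Put v_n = A e_n and b_n = b_{n,h}.  For a finite combination x of the e_n,
    testing A x against a norming functional f and applying Cauchy-Schwarz to
    the pairs (|x_n| sqrt b_n, |(f, v_n)| / sqrt b_n) gives the inequality.
    Applied to the increments of the partial sums x_k of a general x in H_B it
    shows that A x_k is a Cauchy sequence; closability identifies its limit
    with A x, so the inequality passes to the limit.  The weights b_{n,h} and
    b_{n,1} are comparable, hence the supremum is finite for every h.

    For sharpness, fix f in the unit ball and a finite F, and test on the
    combination x of the e_n, n in F, with coefficients (f, v_n) / b_n: with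
    T = \sum_{n in F} |(f, v_n)|^2 / b_n one has (f, A x) = T and
    ||x||_{B,h} = sqrt T, so a constant c satisfies T <= ||A x|| <= c sqrt T,
    that is T <= c^2. *)
Require Import Defs.
From HB Require Import structures.
From mathcomp Require Import all_boot all_order all_algebra.
From mathcomp Require Import finmap.
From mathcomp Require Import all_classical all_reals all_analysis.
From mathcomp.real_closed Require Import complex.
From mathcomp Require Import ring lra.
Set Implicit Arguments.
Unset Strict Implicit.
Unset Printing Implicit Defensive.
Import Order.TTheory GRing.Theory Num.Theory.
Import numFieldNormedType.Exports.
Local Open Scope classical_set_scope.
Local Open Scope ring_scope.

(** * Finite Cauchy-Schwarz inequality and truncation of extended reals *)

Lemma sqr_sum_mul_le (R : realFieldType) (I : Type) (r : seq I) (p q : I -> R) :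
  (\sum_(i <- r) p i * q i) ^+ 2 <=
  (\sum_(i <- r) p i ^+ 2) * (\sum_(i <- r) q i ^+ 2).
Proof.
elim: r => [|i r IH]; first by rewrite !big_nil expr0n mul0r.
rewrite !big_cons.
have P0 : 0 <= \sum_(j <- r) p j ^+ 2 by apply: sumr_ge0 => j _; apply: sqr_ge0.
have Q0 : 0 <= \sum_(j <- r) q j ^+ 2 by apply: sumr_ge0 => j _; apply: sqr_ge0.
move: (\sum_(j <- r) p j ^+ 2) (\sum_(j <- r) q j ^+ 2)
  (\sum_(j <- r) p j * q j) P0 Q0 IH => P Q S P0 Q0 PQ.
move: (p i) (q i) => x y.
(* The cross term obeys the arithmetic-geometric mean inequality, since the induction hypothesis
   gives [S ^+ 2 <= P * Q]. *)
suff : 2 * (S * (x * y)) <= P * y ^+ 2 + Q * x ^+ 2.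
  by move=> D; nra.
apply: le_trans (ler_norm _) _.
have D0 : 0 <= P * y ^+ 2 + Q * x ^+ 2 by rewrite addr_ge0// mulr_ge0// sqr_ge0.
rewrite -ler_sqr ?nnegrE ?normr_ge0// -normrX ger0_norm ?sqr_ge0//.
have : S ^+ 2 * (x * y) ^+ 2 <= P * Q * (x * y) ^+ 2.
  by rewrite ler_wpM2r ?sqr_ge0.
have := sqr_ge0 (P * y ^+ 2 - Q * x ^+ 2); nra.
Qed.

(** An inequality and not an equality, because [fine] sends [-oo] to [0]. *)
Lemma le_EFin_fine (R : realDomainType) (x : \bar R) :
  (x < +oo)%E -> (x <= (fine x)%:E)%E.
Proof. by case: x => [r| |] //= _; exact: leNye. Qed.

Lemma fine_le_EFin (R : realDomainType) (x : \bar R) (r : R) :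
  0 <= r -> (x <= r%:E)%E -> fine x <= r.
Proof. by case: x => [s| |] //=; rewrite leye_eq. Qed.

Lemma sqrte_fine (R : rcfType) (x : \bar R) :
  (x < +oo)%E -> sqrte x = (Num.sqrt (fine x))%:E.
Proof. by case: x => [r| |] //= _; rewrite sqrtr0. Qed.

(** * Real-valued norms and inner products *)

Section RealNorm.
Variable R : realType.

Lemma normr_rnorm (V : normedZmodType R[i]) (v : V) : `|v| = (rnorm v)%:C%C.
Proof. by rewrite /rnorm RRe_real; last exact: ger0_real (normr_ge0 v). Qed.

Lemma rnorm_ge0 (V : normedZmodType R[i]) (v : V) : 0 <= rnorm v.
Proof. by rewrite -lecR -normr_rnorm; exact: normr_ge0. Qed.

Lemma rnorm0 (V : normedZmodType R[i]) : rnorm (0 : V) = 0.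
Proof. by rewrite /rnorm normr0. Qed.

Lemma rnorm_eq0 (V : normedZmodType R[i]) (v : V) : (rnorm v == 0) = (v == 0).
Proof.
rewrite -(normr_eq0 v) normr_rnorm.
by apply/eqP/eqP => [->|/complexI].
Qed.

Lemma ler_rnormD (V : normedZmodType R[i]) (x y : V) :
  rnorm (x + y) <= rnorm x + rnorm y.
Proof. by rewrite -lecR rmorphD /= -!normr_rnorm; exact: ler_normD. Qed.

Lemma rnormM (x y : R[i]) : rnorm (x * y) = rnorm x * rnorm y.
Proof. by apply: complexI; rewrite rmorphM /= -!normr_rnorm normrM. Qed.

Lemma rnormc (x : R) : 0 <= x -> rnorm (x%:C%C : R[i]) = x.
Proof.
by move=> x0; apply: complexI; rewrite -normr_rnorm ger0_norm// lecR.
Qed.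

Lemma ler_rnorm_sum (I : Type) (r : seq I) (g : I -> R[i]) :
  rnorm (\sum_(i <- r) g i) <= \sum_(i <- r) rnorm (g i).
Proof.
rewrite -lecR -normr_rnorm rmorph_sum /=.
apply: le_trans (ler_norm_sum _ _ _) _.
by apply: ler_sum => i _; rewrite normr_rnorm.
Qed.

Lemma conjC_real (x : R) : (x%:C%C : R[i])^* = x%:C%C.
Proof. exact: conjc_real. Qed.

Variable H : hilbertType R.

Lemma inner_rnorm (x : H) : inner H x x = (rnorm x ^+ 2)%:C%C.
Proof. by rewrite innerE normr_rnorm rmorphXn. Qed.

Lemma rnormZ (a : R[i]) (x : H) : rnorm (a *: x) = rnorm a * rnorm x.
Proof. by apply: complexI; rewrite rmorphM /= -!normr_rnorm normrZ. Qed.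

Lemma innerZl (a : R[i]) (x y : H) : inner H (a *: x) y = a * inner H x y.
Proof. exact: linearZl_LR. Qed.

Lemma innerZr (a : R[i]) (x y : H) : inner H x (a *: y) = a^* * inner H x y.
Proof. exact: linearZr_LR. Qed.

Lemma innerC (x y : H) : inner H x y = (inner H y x)^*.
Proof. by rewrite [LHS]hermC /= mul1r. Qed.

Lemma inner_suml (I : Type) (r : seq I) (u : I -> H) (y : H) :
  inner H (\sum_(i <- r) u i) y = \sum_(i <- r) inner H (u i) y.
Proof. by rewrite (big_morph (inner H ^~ y) (linearDl _ y) (linear0l _ y)). Qed.

Lemma inner_sumr (I : Type) (r : seq I) (u : I -> H) (x : H) :
  inner H x (\sum_(i <- r) u i) = \sum_(i <- r) inner H x (u i).
Proof. exact: raddf_sum. Qed.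

(** The witness is [w] divided by its norm; for [w = 0] the zero vector serves. *)
Lemma exists_norming (w : H) :
  exists2 f : H, rnorm f <= 1 & inner H f w = (rnorm w)%:C%C.
Proof.
have [->|w_neq0] := eqVneq w 0.
  by exists 0; rewrite ?rnorm0// linear0r.
have w_gt0 : 0 < rnorm w by rewrite lt_def rnorm_eq0 w_neq0 rnorm_ge0.
exists ((rnorm w)^-1%:C%C *: w).
  by rewrite rnormZ rnormc ?invr_ge0 ?rnorm_ge0// mulVf// lt0r_neq0.
by rewrite innerZl inner_rnorm -rmorphM /= expr2 mulKf//; exact: lt0r_neq0.
Qed.

Lemma le_rnorm_of_inner (f v : H) (t : R) :
  rnorm f <= 1 -> 0 <= t -> inner H f v = t%:C%C -> t <= rnorm v.
Proof.
move=> f1 t0 fv.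
have vf : inner H v f = t%:C%C.
  by rewrite innerC fv conjC_real.
(* This is [|v - t f|^2 >= 0]; the general Cauchy-Schwarz inequality of the
   library is only available in finite dimension. *)
suff : 0 <= rnorm v ^+ 2 - 2 * t * t + t ^+ 2 * rnorm f ^+ 2.
  have := rnorm_ge0 f; have := rnorm_ge0 v; move: (rnorm v) (rnorm f) f1.
  move=> a b b1 a0 b0 D.
  rewrite -ler_sqr ?nnegrE//.
  have b21 : b ^+ 2 <= 1 by rewrite expr_le1.
  have : t ^+ 2 * b ^+ 2 <= t ^+ 2 by rewrite ler_piMr ?sqr_ge0.
  lra.
rewrite -lecR.
have -> : (rnorm v ^+ 2 - 2 * t * t + t ^+ 2 * rnorm f ^+ 2)%:C%C
   = inner H (v - t%:C%C *: f) (v - t%:C%C *: f).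
  rewrite linearBl /= !linearBr /= !innerZl !innerZr fv vf.
  rewrite !inner_rnorm conjC_real.
  rewrite !(rmorphB, rmorphD, rmorphM, rmorphXn) /=.
  ring.
by rewrite inner_rnorm lecR sqr_ge0.
Qed.

End RealNorm.

(** * Duality between finite combinations and quotient sums *)

Section FiniteDuality.
Variables (R : realType) (H : hilbertType R) (I : Type) (r : seq I).
Variables (v : I -> H) (b : I -> R).
Hypothesis b_ge0 : forall i, 0 <= b i.

Definition quot_sum (f : H) : R :=
  \sum_(i <- r | b i != 0) rnorm (inner H f (v i)) ^+ 2 / b i.

Let quot_sumE f : quot_sum f = \sum_(i <- r) rnorm (inner H f (v i)) ^+ 2 / b i.
Proof.
rewrite /quot_sum big_mkcond; apply: eq_bigr => i _.
by case: eqVneq => // ->; rewrite invr0 mulr0.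
Qed.

(** Cauchy-Schwarz after pairing with a norming vector. The first hypothesis removes the terms with
    [b i = 0], where the factor [Num.sqrt (b i)] cannot be cancelled. *)
Lemma rnorm_combination_le (a : I -> R[i]) (s : R) :
  (forall i, b i = 0 -> v i = 0) ->
  (forall f, rnorm f <= 1 -> quot_sum f <= s) ->
  rnorm (\sum_(i <- r) a i *: v i) ^+ 2 <=
    s * \sum_(i <- r) rnorm (a i) ^+ 2 * b i.
Proof.
move=> bv quot_le; set w := \sum_(i <- r) _.
have D0 : 0 <= \sum_(i <- r) rnorm (a i) ^+ 2 * b i.
  by apply: sumr_ge0 => i _; rewrite mulr_ge0 ?sqr_ge0.
have [f f1 fw] := exists_norming w.
have {fw} w_le : rnorm w <=
    \sum_(i <- r) (rnorm (a i) * Num.sqrt (b i)) *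
                  (rnorm (inner H f (v i)) / Num.sqrt (b i)).
  rewrite -[X in X <= _]rnormc ?rnorm_ge0// -fw inner_sumr.
  apply: le_trans (ler_rnorm_sum _ _) _; apply: ler_sum => i _.
  rewrite innerZr rnormM.
  have -> : rnorm (a i)^* = rnorm (a i) by rewrite /rnorm norm_conjC.
  have [bi0|bi_neq0] := eqVneq (b i) 0.
    by rewrite bv// linear0r rnorm0 !mulr0 mul0r mulr0.
  have : Num.sqrt (b i) != 0 by rewrite sqrtr_eq0 -ltNge lt_def bi_neq0 b_ge0.
  by move=> ?; rewrite -mulrA [_ / _]mulrC mulVKf.
apply: (@le_trans _ _ ((\sum_(i <- r) (rnorm (a i) * Num.sqrt (b i)) *
                  (rnorm (inner H f (v i)) / Num.sqrt (b i))) ^+ 2)).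
  by rewrite ler_sqr ?nnegrE ?(le_trans _ w_le) ?rnorm_ge0.
apply: le_trans (sqr_sum_mul_le _ _ _) _; rewrite mulrC.
under eq_bigr do rewrite expr_div_n sqr_sqrtr//.
under [X in _ * X <= _]eq_bigr do rewrite exprMn sqr_sqrtr//.
by rewrite -quot_sumE ler_wpM2r ?quot_le.
Qed.

(* Where [b i = 0] the inverse is [0], so such indices do not contribute. *)
Definition quot_coef (f : H) (i : I) : R[i] := inner H f (v i) * (b i)^-1%:C%C.

Lemma sum_quot_coef_weight f :
  \sum_(i <- r) rnorm (quot_coef f i) ^+ 2 * b i = quot_sum f.
Proof.
rewrite quot_sumE; apply: eq_bigr => i _.
rewrite rnormM rnormc ?invr_ge0// exprMn.
have [->|bi_neq0] := eqVneq (b i) 0; first by rewrite invr0 !mulr0.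
by field.
Qed.

(** Pairing [f] with this combination gives exactly [quot_sum f], a non-negative real, so the bound
    for unit-ball vectors applies. *)
Lemma quot_sum_le_rnorm_combination f : rnorm f <= 1 ->
  quot_sum f <= rnorm (\sum_(i <- r) quot_coef f i *: v i).
Proof.
move=> f1; apply: le_rnorm_of_inner f1 _ _.
  by apply: sumr_ge0 => i _; rewrite divr_ge0 ?sqr_ge0.
rewrite quot_sumE inner_sumr rmorph_sum /=; apply: eq_bigr => i _.
rewrite innerZr rmorphM /= -mulrA mulrC -mulrA -[_ * _^*]normCK conjC_real.
by rewrite normr_rnorm -rmorphXn -rmorphM /= mulrC.
Qed.

End FiniteDuality.

(** * Sums along the exhaustion *)

Section Exhaustion.
Variables (R : realType) (M : countType) (Mk : nat -> {fset M}).
Hypothesis Mk_exh : exhaustion Mk.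

Lemma exhaustion_le k l : (k <= l)%N -> {subset Mk k <= Mk l}.
Proof.
move=> /subnK <-; elim: (l - k)%N => [//|d IH] n /IH.
by rewrite addSn; apply/fsubsetP; exact: Mk_exh.1.
Qed.

Lemma big_exhaustion_split (V : nmodType) (P : pred M) (g : M -> V) k l :
  (k <= l)%N ->
  \sum_(n <- Mk l | P n) g n =
  \sum_(n <- Mk k | P n) g n + \sum_(n <- Mk l | P n && (n \notin Mk k)) g n.
Proof.
move=> kl; rewrite (bigID (fun n => n \in Mk k)) /=; congr (_ + _).
under eq_bigl do rewrite andbC.
(* By nestedness, the part of [Mk l] inside [Mk k] is a permutation of [Mk k]. *)
rewrite -big_filter_cond; apply: perm_big; apply: uniq_perm.
- exact: filter_uniq (fset_uniq _).
- exact: fset_uniq.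
- move=> n; rewrite mem_filter; apply/andP/idP => [[]//|nk].
  by split=> //; exact: exhaustion_le nk.
Qed.

Lemma big_exhaustion_diff (V : zmodType) (g : M -> V) k l : (k <= l)%N ->
  \sum_(n <- Mk l) g n - \sum_(n <- Mk k) g n =
  \sum_(n <- Mk l | n \notin Mk k) g n.
Proof.
by move=> kl; rewrite (big_exhaustion_split xpredT g kl) addrAC subrr add0r.
Qed.

Lemma le_big_exhaustion (P : pred M) (a : M -> R) k l :
  (forall n, 0 <= a n) -> (k <= l)%N ->
  \sum_(n <- Mk k | P n) a n <= \sum_(n <- Mk l | P n) a n.
Proof.
by move=> a0 kl; rewrite (big_exhaustion_split P a kl) lerDl sumr_ge0.
Qed.

Let partial_sums_homo (P : pred M) (a : M -> R) : (forall n, 0 <= a n) ->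
  {homo (fun k => (\sum_(n <- Mk k | P n) (a n)%:E)%E) :
     k l / (k <= l)%N >-> (k <= l)%E}.
Proof. by move=> a0 k l kl; rewrite !sumEFin lee_fin le_big_exhaustion. Qed.

(** Partial sums of non-negative terms increase along the exhaustion, so their limit is their
    supremum. *)
Lemma msum_on_leP (P : pred M) (a : M -> R) (s : R) : (forall n, 0 <= a n) ->
  (msum_on Mk P a <= s%:E)%E <->
  forall k, \sum_(n <- Mk k | P n) a n <= s.
Proof.
move=> a0; have a_homo := partial_sums_homo P a0.
have -> : msum_on Mk P a = ereal_sup
    (range (fun k => (\sum_(n <- Mk k | P n) (a n)%:E)%E)).
  by apply/cvg_lim => //; exact: ereal_nondecreasing_cvgn.
split=> [le_s k|le_s].
  rewrite -lee_fin; apply: le_trans le_s; rewrite -sumEFin.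
  by apply: ereal_sup_ubound; exists k.
by apply: ge_ereal_sup => _ [k _ <-]; rewrite sumEFin lee_fin.
Qed.

(** A real bound excludes the infinite branch of [wsum], which is the first condition; the second is
    the bound on partial sums. *)
Lemma wsum_leP (a b : M -> R) (s : R) :
  (forall n, 0 <= a n) -> (forall n, 0 <= b n) ->
  (wsum Mk a b <= s%:E)%E <->
  (forall n, b n = 0 -> a n = 0) /\
  (forall k, \sum_(n <- Mk k | b n != 0) a n / b n <= s).
Proof.
move=> a0 b0; rewrite /wsum; case: ifPn => [/asboolP[n [/eqP an0 bn0]]|nex].
  by rewrite leye_eq; split=> // -[ab _]; case: an0; exact: ab.
rewrite msum_on_leP => [|n]; last by rewrite divr_ge0.
split=> [le_s|[]//]; split=> // n bn0; apply/eqP/negPn/negP => an0.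
by move/asboolPn: nex; apply; exists n.
Qed.

End Exhaustion.

(** * Operators on finite combinations, closability and limits *)

Section Operators.
Variables (R : realType) (H H' : hilbertType R).

Lemma op_sum (I : Type) (r : seq I) (T : operator H H') (a : I -> R[i])
    (u : I -> H) : (forall i, dom T (u i)) ->
  dom T (\sum_(i <- r) a i *: u i) /\
  T (\sum_(i <- r) a i *: u i) = \sum_(i <- r) a i *: T (u i).
Proof.
have [dom0 domZD] := dom_submod T.
move=> domu; elim: r => [|i r [dom_r T_r]].
  rewrite !big_nil; split; first by move: dom0; rewrite inE.
  have T0 : dom T 0 by move: dom0; rewrite inE.
  (* [T 0 = 0] follows from [op_linear] with scalar [-1] and both vectors zero. *)
  apply: (@addIr _ (T 0)); rewrite add0r.
  have := op_linear (-1) T0 T0.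
  by rewrite scaler0 addr0 scaleN1r addNr => ->; rewrite add0r.
rewrite !big_cons; split; last by rewrite op_linear// T_r.
have : a i *: u i + \sum_(j <- r) a j *: u j \in [in dom T].
  by apply: domZD; rewrite inE.
by rewrite inE.
Qed.

(** Both [(x, y)] and [(x, T x)] lie in the closure of the graph, which is the graph of a
    single-valued [S]. *)
Lemma closable_limit (T : operator H H') (u : nat -> H) (x : H) (y : H') :
  closable_op T -> (forall k, dom T (u k)) -> dom T x ->
  u @ \oo --> x -> (T \o u) @ \oo --> y -> y = T x.
Proof.
move=> [S clT] domu domx ux Ty.
have : graph S (x, y).
  rewrite -clT => V; have := cvg_pair ux Ty => /[apply] -[k _ Vk].
  exists (u k, T (u k)); split; last exact: (Vk k (leqnn k)).
  by split=> //=; exact: domu.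
have : graph S (x, T x) by rewrite -clT; apply: subset_closure.
by move=> [_ /= TS] [_ /= yS]; rewrite yS TS.
Qed.

(** A positive element of [R[i]] is real, so real radii suffice. *)
Lemma rnorm_cauchy_cvg (V : completeNormedModType R[i]) (u : nat -> V) :
  (forall eps : R, 0 < eps -> exists K, forall k, (K <= k)%N ->
     rnorm (u k - u K) < eps) ->
  cvgn u.
Proof.
move=> u_cauchy; apply: cauchy_cvg; apply: cauchy_exP => eps eps_gt0.
have eps_real : eps = (complex.Re eps)%:C%C by rewrite RRe_real// gtr0_real.
have [|K uK] := u_cauchy (complex.Re eps); first by rewrite -ltcR -eps_real.
exists (u K), K => // k Kk.
by rewrite -ball_normE /= distrC normr_rnorm eps_real ltcR uK.
Qed.

Lemma rnorm_cvg_le (V : completeNormedModType R[i]) (u : nat -> V) (y : V)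
    (c : R) :
  u @ \oo --> y -> (forall k, rnorm (u k) <= c) -> rnorm y <= c.
Proof.
move=> uy uc; apply/ler_addgt0Pr => eps eps_gt0.
have epsC : 0 < eps%:C%C :> R[i] by rewrite ltcR.
have /cvgr_dist_le/(_ _ epsC)[k _ /(_ k (leqnn k)) /=] := uy.
rewrite normr_rnorm lecR => yk.
rewrite -[y](subrK (u k)).
apply: le_trans (_ : rnorm (y - u k) + rnorm (u k) <= _).
  exact: ler_rnormD.
by rewrite addrC lerD.
Qed.

End Operators.

(** * The bound for a fixed weight, and finite test vectors *)

Section Bound.
Variables (R : realType) (H H' : hilbertType R).
Variables (M : countType) (Mk : nat -> {fset M}) (e : M -> H).
Variables (A : operator H H') (b : M -> R).
Hypothesis Mk_exh : exhaustion Mk.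
Hypothesis e_basis : orthonormal_basis Mk e.
Hypothesis e_domA : forall n, dom A (e n).
Hypothesis A_closable : closable_op A.
Hypothesis b_ge0 : forall n, 0 <= b n.

(** The finite inequality is carried to [x] along its partial expansions [xk]. All bounds are on
    finite sums, so the argument stays in the reals. *)
Lemma rnorm_op_le (s t : R) (x : H) : 0 <= s -> dom A x ->
  (forall n, b n = 0 -> A (e n) = 0) ->
  (forall f, rnorm f <= 1 -> forall k, quot_sum (Mk k) (A \o e) b f <= s) ->
  (forall k, \sum_(n <- Mk k) rnorm (inner H x (e n)) ^+ 2 * b n <= t) ->
  rnorm (A x) ^+ 2 <= s * t.
Proof.
move=> s0 domx bA quot_le T_le.
pose xk k := \sum_(n <- Mk k) inner H x (e n) *: e n.
pose c n := rnorm (inner H x (e n)) ^+ 2 * b n.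
pose T k := \sum_(n <- Mk k) c n.
have c_ge0 n : 0 <= c n by rewrite mulr_ge0 ?sqr_ge0.
have AxkE k : A (xk k) = \sum_(n <- Mk k) inner H x (e n) *: A (e n).
  by apply: (op_sum _ _ _).2.
have dom_xk k : dom A (xk k) by apply: (op_sum _ _ _).1.
(* The increment is a combination over [Mk l] outside [Mk k]; its quotient sum omits non-negative
   terms of the one over [Mk l], so [s] still bounds it. *)
have A_diff k l : (k <= l)%N ->
    rnorm (A (xk l) - A (xk k)) ^+ 2 <= s * (T l - T k).
  move=> kl; rewrite !AxkE /T.
  rewrite (big_exhaustion_diff Mk_exh c kl).
  rewrite (big_exhaustion_diff Mk_exh (fun n => inner H x (e n) *: A (e n)) kl).
  rewrite -big_filter -[X in _ <= s * X]big_filter.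
  apply: (@rnorm_combination_le _ _ _ _ (A \o e)) => // f f1.
  apply: le_trans (quot_le f f1 l).
  rewrite /quot_sum big_filter_cond.
  rewrite [X in _ <= X](bigID (fun n => n \in Mk k)) /=.
  under [X in _ <= _ + X]eq_bigl do rewrite andbC.
  rewrite lerDr; apply: sumr_ge0 => n _.
  by rewrite divr_ge0 ?sqr_ge0.
have A_le k : rnorm (A (xk k)) ^+ 2 <= s * t.
  rewrite AxkE; apply: (@le_trans _ _ (s * T k)); last first.
    by apply: ler_wpM2l => //; exact: T_le.
  by apply: (@rnorm_combination_le _ _ _ _ (A \o e)) => // f f1; exact: quot_le.
have st0 : 0 <= s * t by apply: le_trans (A_le 0%N); exact: sqr_ge0.
have Axk_cvg : cvgn (A \o xk).
  apply: rnorm_cauchy_cvg => eps eps0.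
  have supT : has_sup (range T).
    by split; [exists (T 0%N), 0%N|exists t => _ [k _ <-]; exact: T_le].
  (* Dividing by [s + 1] allows [s = 0]. Once [T K] is within [eps ^+ 2 / (s + 1)] of the supremum,
     [A_diff] makes every later increment from [K] smaller than [eps]. *)
  have s1 : 0 < s + 1 by rewrite ltr_wpDl.
  have d0 : 0 < eps ^+ 2 / (s + 1) by rewrite divr_gt0// exprn_gt0.
  have [_ [K _ <-] TK] := sup_adherent d0 supT.
  exists K => k Kk /=.
  rewrite -ltr_sqr ?nnegrE ?rnorm_ge0 ?(ltW eps0)//.
  apply: le_lt_trans (A_diff _ _ Kk) _.
  have Tk : T k <= sup (range T) by apply: sup_ubound; [case: supT|exists k].
  have TKk : 0 <= T k - T K by rewrite subr_ge0 le_big_exhaustion.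
  apply: (@le_lt_trans _ _ ((s + 1) * (T k - T K))).
    by rewrite ler_wpM2r// lerDl.
  rewrite mulrC -ltr_pdivlMr//; lra.
have xk_cvg : xk @ \oo --> x by exact: e_basis.2.
have <- := closable_limit A_closable dom_xk domx xk_cvg Axk_cvg.
rewrite -[s * t]sqr_sqrtr// ler_sqr ?nnegrE ?rnorm_ge0 ?sqrtr_ge0//.
apply: rnorm_cvg_le Axk_cvg _ => k /=.
by rewrite -ler_sqr ?nnegrE ?rnorm_ge0 ?sqrtr_ge0// sqr_sqrtr.
Qed.

Lemma inner_combination (r : seq M) (a : M -> R[i]) n : uniq r ->
  inner H (\sum_(i <- r) a i *: e i) (e n) = if n \in r then a n else 0.
Proof.
move=> r_uniq; rewrite inner_suml.
under eq_bigr do rewrite innerZl e_basis.1 eq_sym.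
case: ifPn => [nr|nr].
  rewrite (bigD1_seq n)//= eqxx mulr1 big1 ?addr0// => i /negPf.
  by rewrite eq_sym => ->; rewrite mulr0.
rewrite big_seq big1 // => i ir; case: eqVneq => [nE|]; last by rewrite mulr0.
by move: nr; rewrite nE ir.
Qed.

(** Coefficients outside [Mk k] vanish by orthonormality. The upper bound alone serves both
    membership in [HB_space] and the sharpness test. *)
Lemma combination_msum_le k (a : M -> R[i]) (w : M -> R) :
  (forall n, 0 <= w n) ->
  (Defs.msum Mk (fun n =>
     (rnorm (inner H (\sum_(i <- Mk k) a i *: e i) (e n)) ^+ 2 * w n)%R)
   <= (\sum_(n <- Mk k) rnorm (a n) ^+ 2 * w n)%:E)%E.
Proof.
move=> w0; set g := (fun n : M => _).
have g0 n : 0 <= g n by rewrite mulr_ge0 ?sqr_ge0.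
have gk : \sum_(n <- Mk k) rnorm (a n) ^+ 2 * w n = \sum_(n <- Mk k) g n.
  rewrite !big_seq; apply: eq_bigr => n nk.
  by rewrite /g inner_combination ?nk ?fset_uniq.
apply/(msum_on_leP Mk_exh) => // l; rewrite gk.
(* Up to [k] the partial sums increase; beyond [k] only zero terms are added. *)
have [lk|/ltnW kl] := leqP l k; first exact: le_big_exhaustion.
rewrite (big_exhaustion_split Mk_exh _ _ kl) /=.
rewrite [X in _ + X]big1 ?addr0// => n nk.
by rewrite /g inner_combination ?fset_uniq// (negPf nk) rnorm0 expr0n mul0r.
Qed.

End Bound.

(** * Comparison of weights and finiteness of the supremum *)

Section Weights.
Variables (R : realType) (H H' : hilbertType R).
Variables (M : countType) (Mk : nat -> {fset M}) (e : M -> H) (m : nat).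
Variables (B : 'I_m.+1 -> operator H H') (A : operator H H').
Hypothesis Mk_exh : exhaustion Mk.

Lemma weight_ge0 (h : 'I_m.+1 -> R) n : (forall j, 0 < h j) ->
  0 <= weight e B h n.
Proof.
by move=> h0; apply: sumr_ge0 => j _; rewrite mulr_ge0 ?sqr_ge0 ?ltW.
Qed.

(** Each ratio [g j / h j] is at most the sum of all of them, which is taken as [K]; it is positive
    since there are [m.+1] positive ratios. *)
Lemma weight_comparison (h g : 'I_m.+1 -> R) :
  (forall j, 0 < h j) -> (forall j, 0 < g j) ->
  exists2 K, 0 < K & forall n, weight e B g n <= K * weight e B h n.
Proof.
move=> h0 g0; exists (\sum_j g j / h j).
  rewrite big_ord_recl ltr_pwDl ?divr_gt0//.
  by apply: sumr_ge0 => i _; rewrite divr_ge0 ?ltW.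
move=> n; rewrite /weight mulr_sumr; apply: ler_sum => j _.
rewrite [X in _ <= X]mulrA ler_wpM2r ?sqr_ge0// -ler_pdivrMr//.
rewrite (bigD1 j)//= lerDl; apply: sumr_ge0 => i _.
by rewrite divr_ge0 ?ltW.
Qed.

Lemma sup_wsum_leP (h : 'I_m.+1 -> R) (s : R) : (forall j, 0 < h j) ->
  (sup_wsum Mk e B A h <= s%:E)%E <->
  (forall n, weight e B h n = 0 -> A (e n) = 0) /\
  (forall f, rnorm f <= 1 -> forall k,
     quot_sum (Mk k) (A \o e) (weight e B h) f <= s).
Proof.
move=> h0; have b0 n := weight_ge0 n h0.
have leP f := wsum_leP Mk_exh s
  (fun n => sqr_ge0 (rnorm (inner H' f (A (e n))))) b0.
split=> [sup_le|[bA quot_le]].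
  have wsum_le f : rnorm f <= 1 ->
      (wsum Mk (fun n => (rnorm (inner H' f (A (e n))) ^+ 2)%R)
         (weight e B h) <= s%:E)%E.
    by move=> f1; apply: le_trans sup_le; apply: ereal_sup_ubound; exists f.
  split=> [n bn0|f /wsum_le/leP[]//].
  (* A vector norming [A (e n)] turns the vanishing of all its pairings into [A (e n) = 0]. *)
  have [f /wsum_le/leP[/(_ n bn0)/eqP + _] fA] := exists_norming (A (e n)).
  by rewrite fA rnormc ?rnorm_ge0// sqrf_eq0 rnorm_eq0 => /eqP.
apply: ge_ereal_sup => _ [f f1 <-]; apply/leP; split=> [n /bA->|k].
  by rewrite linear0r rnorm0 expr0n.
exact: quot_le.
Qed.

Lemma sup_wsum_fin (h g : 'I_m.+1 -> R) :
  (forall j, 0 < h j) -> (forall j, 0 < g j) ->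
  (sup_wsum Mk e B A g < +oo)%E -> (sup_wsum Mk e B A h < +oo)%E.
Proof.
move=> h0 g0 /le_EFin_fine; set s := fine _.
move=> /(sup_wsum_leP _ g0)[bA quot_le].
have [K K0 leK] := weight_comparison h0 g0.
(* Comparison in both directions makes the two weights vanish at the same indices, so both quotient
   sums run over the same terms. *)
have hg n : (weight e B h n == 0) = (weight e B g n == 0).
  have [K' K'0 leK'] := weight_comparison g0 h0.
  apply/eqP/eqP => b0; apply/eqP; rewrite eq_le weight_ge0// andbT.
    by rewrite (le_trans (leK n))// b0 mulr0.
  by rewrite (le_trans (leK' n))// b0 mulr0.
apply: (@le_lt_trans _ _ (K * s)%:E); last exact: ltry.
apply/sup_wsum_leP => //; split=> [n /eqP|f f1 k].
  by rewrite hg => /eqP/bA.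
apply: (@le_trans _ _
  (K * quot_sum (Mk k) (A \o e) (weight e B g) f)); last first.
  by apply: ler_wpM2l; [exact: ltW|exact: quot_le].
rewrite /quot_sum mulr_sumr (eq_bigl _ _ (fun n => congr1 negb (hg n))).
apply: ler_sum => n bn0.
have g_gt0 : 0 < weight e B g n by rewrite lt_def bn0 weight_ge0.
have h_gt0 : 0 < weight e B h n by rewrite lt_def hg bn0 weight_ge0.
rewrite mulrCA ler_wpM2l ?sqr_ge0//.
by rewrite ler_pdivlMr// mulrC ler_pdivrMr.
Qed.

(** Each partial sum splits into [m.+1] sums, one for each [B j], all bounded on [HB_space]. *)
Lemma HB_space_weight (h : 'I_m.+1 -> R) x : (forall j, 0 < h j) ->
  HB_space Mk e B x ->
  (Defs.msum Mk (fun n => (rnorm (inner H x (e n)) ^+ 2 * weight e B h n)%R)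
     < +oo)%E.
Proof.
move=> h0 xB.
pose t j := fine (Defs.msum Mk (fun n =>
  rnorm (inner H x (e n)) ^+ 2 * rnorm (B j (e n)) ^+ 2)).
apply: (@le_lt_trans _ _ (\sum_j h j * t j)%:E); last exact: ltry.
apply/(msum_on_leP Mk_exh) => [n|k].
  by rewrite mulr_ge0 ?sqr_ge0 ?weight_ge0.
under eq_bigr do rewrite mulr_sumr.
rewrite exchange_big /=; apply: ler_sum => j _.
under eq_bigr do rewrite mulrCA.
rewrite -mulr_sumr ler_wpM2l ?(ltW (h0 j))//.
have /le_EFin_fine/(msum_on_leP Mk_exh) := xB j; apply.
by move=> n; rewrite mulr_ge0 ?sqr_ge0.
Qed.

End Weights.

(** * The inequality and its sharpness for every [h] *)

Theorem theorem6 (R : realType) (H H' : hilbertType R)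
    (M : countType) (Mk : nat -> {fset M}) (e : M -> H)
    (m : nat) (B : 'I_m.+1 -> operator H H') (A : operator H H')
    (Mk_exh : exhaustion Mk)
    (e_basis : orthonormal_basis Mk e)
    (B_closed : forall j, closed_op (B j))
    (e_domB : forall j n, dom (B j) (e n))
    (B_orth : forall j n n', n != n' ->
       inner H' (B j (e n)) (B j (e n')) = 0)
    (B_neq0 : exists j n, B j (e n) != 0)
    (A_closable : closable_op A)
    (e_domA : forall n, dom A (e n))
    (A_neq0 : exists n, A (e n) != 0)
    (sup_fin : (sup_wsum Mk e B A (fun _ => 1%R) < +oo)%E) :
  forall h : 'I_m.+1 -> R, (forall j, 0 < h j) ->
    (forall x : H, dom A x -> HB_space Mk e B x ->
       ((rnorm (A x))%:E
          <= sqrte (sup_wsum Mk e B A h) * seminormB Mk e B h x)%E) /\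
    (forall c : R,
       (forall x : H, dom A x -> HB_space Mk e B x ->
          ((rnorm (A x))%:E <= c%:E * seminormB Mk e B h x)%E) ->
       (sqrte (sup_wsum Mk e B A h) <= c%:E)%E).
Proof.
move=> h h0.
have S_fin := sup_wsum_fin Mk_exh h0 (fun=> ltr01) sup_fin.
have b0 n := weight_ge0 e B n h0.
have [bA quot_le] := (sup_wsum_leP e B A Mk_exh _ h0).1 (le_EFin_fine S_fin).
set s := fine _ in quot_le.
have s0 : 0 <= s.
  apply: le_trans (quot_le 0 _ 0%N); last by rewrite rnorm0.
  by apply: sumr_ge0 => n _; rewrite divr_ge0 ?sqr_ge0.
split=> [x domx xB|c c_bound].
  have t_fin := HB_space_weight Mk_exh h0 xB.
  rewrite /seminormB !sqrte_fine// -EFinM lee_fin -sqrtrM//.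
  rewrite -[X in X <= _]ger0_norm ?rnorm_ge0// -sqrtr_sqr ler_wsqrtr//.
  apply: (rnorm_op_le Mk_exh e_basis) => //.
  apply/(msum_on_leP Mk_exh) => [n|]; first by rewrite mulr_ge0 ?sqr_ge0.
  exact: le_EFin_fine.
(* Here [d] is the seminorm of the combination. Only an upper bound on it is recorded, so the sign
   of [c] is needed before that bound can replace [d]. *)
have comb_le k (a : M -> R[i]) (x := \sum_(n <- Mk k) a n *: e n) :
    exists2 d,
      0 <= d <=
        Num.sqrt (\sum_(n <- Mk k) rnorm (a n) ^+ 2 * weight e B h n) &
      rnorm (\sum_(n <- Mk k) a n *: A (e n)) <= c * d.
  have msum_le := combination_msum_le Mk_exh e_basis k a.
  have [domx <-] := op_sum (Mk k) a e_domA.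
  have xB : HB_space Mk e B x.
    by move=> j; apply: le_lt_trans (msum_le _ _) (ltry _) => n; exact: sqr_ge0.
  have t_fin := HB_space_weight Mk_exh h0 xB.
  exists (Num.sqrt (fine (Defs.msum Mk
    (fun n => rnorm (inner H x (e n)) ^+ 2 * weight e B h n)))).
    rewrite sqrtr_ge0 ler_wsqrtr//; apply: fine_le_EFin (msum_le _ b0).
    by apply: sumr_ge0 => n _; rewrite mulr_ge0 ?sqr_ge0.
  have := c_bound x domx xB.
  by rewrite /seminormB sqrte_fine// -EFinM lee_fin.
(* Testing on a basis vector with [A (e n) != 0]: a negative [c] would force its image to have norm
   at most zero. *)
have c0 : 0 <= c.
  have [n An] := A_neq0; have [k nk] := Mk_exh.2 n.
  have [d /andP[d0 _]] := comb_le k (fun i => (i == n)%:R).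
  rewrite (bigD1_seq n) ?fset_uniq//= eqxx scale1r big1; last first.
    by move=> i /negPf->; rewrite scale0r.
  rewrite addr0 => An_le; rewrite leNgt; apply/negP => c_lt0; case/negP: An.
  rewrite -rnorm_eq0 eq_le rnorm_ge0 andbT (le_trans An_le)//.
  by rewrite mulr_le0_ge0// ltW.
rewrite -(ger0_norm c0) -sqrtr_sqr -[X in (_ <= X)%E]/(sqrte (c ^+ 2)%:E).
rewrite lee_sqrt ?lee_fin ?sqr_ge0//.
apply/(sup_wsum_leP _ _ _ Mk_exh) => //; split=> // f f1 k.
set T := quot_sum _ _ _ _.
have T0 : 0 <= T by apply: sumr_ge0 => n _; rewrite divr_ge0 ?sqr_ge0.
(* With the extremal coefficients the squared seminorm bound is [T] itself, which leads to
   [T <= c * Num.sqrt T]. *)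
have [d /andP[d0 dT]] := comb_le k (quot_coef (A \o e) (weight e B h) f).
rewrite sum_quot_coef_weight// -/T in dT.
move=> /(le_trans (quot_sum_le_rnorm_combination _ _ b0 f1)) T_le.
have {}T_le : T <= c * Num.sqrt T.
  by apply: le_trans T_le _; exact: ler_wpM2l.
(* The case [T = 0] is separated so that [Num.sqrt T] can be cancelled. *)
have [->|T_neq0] := eqVneq T 0; first exact: sqr_ge0.
have sT : 0 < Num.sqrt T by rewrite sqrtr_gt0 lt_def T_neq0.
rewrite -[T]sqr_sqrtr// ler_sqr ?nnegrE ?(ltW sT)//.
by rewrite -(ler_pM2r sT) -expr2 sqr_sqrtr.
Qed.
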